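(* There exists an absolute constant $c>0$ such that for every $n\in\mathbb{N}$ and every convex polytope $P\subset\mathbb{R}^n$ which is centrally symmetric (meaning $P=-P$), $$\log|V|\cdot\log|\mathcal{F}|\ \geq\ c\,n,$$ where $V$ is the set of vertices and $\mathcal{F}$ is the set of facets of $P$.
   Context: A polytope in $\mathbb{R}^n$ is the convex hull of finitely many points with non-empty interior. Vertices are its $0$-dimensional faces and facets are its $(n-1)$-dimensional faces. Logarithms are natural. *)

(* Defs.v *)
(* R^n is the space of row vectors 'rV[R]_n over a realType,
   with the topology of matrix_topology. *)
From HB Require Import structures.
From mathcomp Require Import all_boot all_order all_algebra finmap.
From mathcomp Require Import all_classical all_reals all_analysis.

Set Implicit Arguments.
Unset Strict Implicit.
Unset Printing Implicit Defensive.

Import Order.TTheory GRing.Theory Num.Theory.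
Import numFieldNormedType.Exports.

Local Open Scope classical_set_scope.
Local Open Scope ring_scope.

Definition dotv (R : realType) (n : nat) (u x : 'rV[R]_n) : R :=
  \sum_(i < n) u 0 i * x 0 i.

Definition conv_hull (R : realType) (n : nat) (A : set 'rV[R]_n) :
    set 'rV[R]_n :=
  [set y | exists (m : nat) (p : 'I_m -> 'rV[R]_n) (a : 'I_m -> R),
    [/\ forall i, A (p i), forall i, 0 <= a i, \sum_(i < m) a i = 1
      & y = \sum_(i < m) a i *: p i]].

Definition aff_hull (R : realType) (n : nat) (A : set 'rV[R]_n) :
    set 'rV[R]_n :=
  [set y | exists (m : nat) (p : 'I_m -> 'rV[R]_n) (a : 'I_m -> R),
    [/\ forall i, A (p i), \sum_(i < m) a i = 1
      & y = \sum_(i < m) a i *: p i]].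

Definition polytope (R : realType) (n : nat) (P : set 'rV[R]_n) : Prop :=
  (exists2 S : set 'rV[R]_n, finite_set S & P = conv_hull S)
  /\ interior P !=set0.

Definition centrally_symmetric (R : realType) (n : nat) (P : set 'rV[R]_n) :
    Prop :=
  P = [set - x | x in P].

(* The affine hull of A is a translate of a linear subspace of dimension d.
   The empty set has no dimension in this sense. *)
Definition has_affdim (R : realType) (n : nat) (A : set 'rV[R]_n) (d : nat) :
    Prop :=
  exists (x0 : 'rV[R]_n) (W : {vspace 'rV[R]_n}),
    \dim W = d /\ aff_hull A = [set x0 + w | w in [set w | w \in W]].

(* u = 0 is allowed: it yields the improper faces P and set0, which are
   discriminated by their dimension. *)
Definition is_face (R : realType) (n : nat) (P F : set 'rV[R]_n) : Prop :=
  exists (u : 'rV[R]_n) (h : R),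
    (forall x, P x -> dotv u x <= h) /\ F = [set x | P x /\ dotv u x = h].

Definition vertices (R : realType) (n : nat) (P : set 'rV[R]_n) :
    set (set 'rV[R]_n) :=
  [set F | is_face P F /\ has_affdim F 0].

(* d.+1 = n rather than d = n.-1, so that for n = 0 the point P is not counted
   as a facet of itself. *)
Definition facets (R : realType) (n : nat) (P : set 'rV[R]_n) :
    set (set 'rV[R]_n) :=
  [set F | is_face P F /\ exists2 d : nat, d.+1 = n & has_affdim F d].

(* fset_set is the empty fset on infinite sets; the faces of a polytope are
   finitely many, so this value is not reached below. *)
Definition card_set (T : choiceType) (A : set T) : nat := #|` fset_set A|%fset.

(* Main.v *)
Require Import Defs.
From HB Require Import structures.
From mathcomp Require Import all_boot all_order all_algebra finmap.
From mathcomp Require Import all_classical all_reals all_analysis.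
From mathcomp Require Import perm ring lra zify.

Set Implicit Arguments.
Unset Strict Implicit.
Unset Printing Implicit Defensive.

Import Order.TTheory GRing.Theory Num.Theory.
Import numFieldNormedType.Exports.

Local Open Scope classical_set_scope.
Local Open Scope ring_scope.

(** Write P = conv {s_1, ..., s_m} and let P^o = {u : <u, s_i> <= 1 for all i}
    be its polar.  The proof pairs a random point with its dual.

    Choose weights c on the simplex maximizing the determinant of
    M = sum_i c_i s_i^T s_i (the D-optimal design; up to scale, the ellipsoid
    of M^-1 is the one of least volume around P).  First-order optimality at c
    says that s_i M^-1 s_i^T <= n for every i ([exists_optimal_design]); this
    plays the role of the distance sqrt n to the Euclidean ball in John's
    theorem.  For independent random signs eps_i put
        X = sum_i eps_i sqrt(c_i) s_i     and     Y = X M^-1.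
    Then <X, Y> has mean tr (M M^-1) = n ([avg_random_point_form]).  For u in
    P^o, <X, u> is a sum of independent signs whose coefficients have sum of
    squares sum_i c_i <u, s_i>^2 <= 1, because central symmetry gives
    |<u, s_i>| <= 1; for s = s_k, <Y, s> is such a sum with sum of squares
    s M^-1 s^T <= n.  Such sums are subgaussian, so the maximum of N of them has
    second moment of order log N times the bound on the sums of squares
    ([rad_max]).

    The support function of P at Y is attained at a vertex
    ([exists_max_vertex]), and the gauge of P at X, the maximum of <X, u> over
    P^o, is attained at a u supporting a facet ([purify],
    [polar_face_facet]).  As <X, Y> is at most the gauge at X times the support
    function at Y, averaging gives n <= C sqrt n sqrt(log |F|) sqrt(log |V|),
    which is the claim. *)

(** * Averages over random signs *)

Definition sgn_avg (R : realType) (m : nat)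
    (f : {ffun 'I_m -> bool} -> R) : R :=
  (2^-1) ^+ m * \sum_e f e.

Definition rad (R : realType) (m : nat) (a : 'I_m -> R)
    (e : {ffun 'I_m -> bool}) : R :=
  \sum_(i < m) (-1) ^+ e i * a i.

Lemma sgn_avgD (R : realType) m (f g : {ffun 'I_m -> bool} -> R) :
  sgn_avg (fun e => f e + g e) = sgn_avg f + sgn_avg g.
Proof. by rewrite /sgn_avg big_split mulrDr. Qed.

Lemma sgn_avgZ (R : realType) m (k : R) (f : {ffun 'I_m -> bool} -> R) :
  sgn_avg (fun e => k * f e) = k * sgn_avg f.
Proof. by rewrite /sgn_avg -mulr_sumr mulrCA. Qed.

Lemma sgn_avg_sum (R : realType) m (J : Type) (r : seq J) (P : pred J)
    (f : J -> {ffun 'I_m -> bool} -> R) :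
  sgn_avg (fun e => \sum_(j <- r | P j) f j e)
  = \sum_(j <- r | P j) sgn_avg (f j).
Proof. by rewrite /sgn_avg exchange_big mulr_sumr. Qed.

Lemma sgn_avg_cst (R : realType) m (k : R) :
  @sgn_avg R m (fun=> k) = k.
Proof.
rewrite /sgn_avg sumr_const card_ffun card_bool card_ord.
rewrite -[k *+ _]mulr_natl natrX.
by rewrite mulrA -exprMn mulVf ?expr1n ?mul1r.
Qed.

Lemma ler_sgn_avg (R : realType) m (f g : {ffun 'I_m -> bool} -> R) :
  (forall e, f e <= g e) -> sgn_avg f <= sgn_avg g.
Proof.
move=> fg; rewrite /sgn_avg ler_wpM2l ?exprn_ge0 ?invr_ge0 //.
exact: ler_sum.
Qed.

Lemma sgn_avg_mul (R : realType) m (i j : 'I_m) :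
  @sgn_avg R m (fun e => (-1) ^+ e i * (-1) ^+ e j) = (i == j)%:R.
Proof.
have [->|neq_ij] := eqVneq i j.
  rewrite -[RHS](sgn_avg_cst m); congr (_ * _); apply: eq_bigr => e _.
  by rewrite -expr2 sqrr_sign.
(* reversing the i-th sign reverses the product *)
pose flip (e : {ffun 'I_m -> bool}) :=
  [ffun k => if k == i then ~~ e k else e k].
have flipK : involutive flip.
  move=> e; apply/ffunP=> k; rewrite !ffunE; case: (k == i) => //=.
  by rewrite negbK.
have eqN : \sum_(e : {ffun 'I_m -> bool}) (-1) ^+ e i * (-1) ^+ e j
    = - \sum_(e : {ffun 'I_m -> bool}) (-1) ^+ e i * (-1) ^+ e j :> R.
  rewrite {1}(reindex_inj (inv_inj flipK)) /= -sumrN; apply: eq_bigr => e _.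
  rewrite !ffunE eqxx eq_sym (negbTE neq_ij) signrN mulNr //.
rewrite /sgn_avg; set s := \sum_e _ in eqN *.
suff -> : s = 0 by rewrite mulr0.
lra.
Qed.

(** Only the order of the exponent matters, and the constant 2 in place of the
    sharp 1/2 leaves a proof from 1 + x <= exp x alone: for a^2 <= 1/2, bound
    exp (-a) and exp a by (1 + a)^-1 and (1 - a)^-1, whose mean is
    (1 - a^2)^-1; otherwise a >= 1/2 and cosh a <= exp a already suffices. *)
Lemma cosh_le (R : realType) (a : R) :
  2^-1 * (expR a + expR (- a)) <= expR (2 * a ^+ 2).
Proof.
wlog a0 : a / 0 <= a => [hw|].
  have [/hw//|/ltW a0] := leP 0 a.
  by rewrite addrC -(sqrrN a) -{2}[a]opprK hw ?oppr_ge0.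
have [a2|a2] := leP (2 * a ^+ 2) 1; last first.
  have a12 : 2^-1 <= a by nra.
  have h1 : expR a <= expR (2 * a ^+ 2) by rewrite ler_expR; nra.
  have h2 : expR (- a) <= expR a by rewrite ler_expR; lra.
  by lra.
have a1 : a < 1 by nra.
have hN : expR a <= (1 - a)^-1.
  rewrite -[a]opprK expRN opprK lef_pV2 ?posrE ?expR_gt0 ?subr_gt0 //.
  exact: expR_ge1Dx.
have hP : expR (- a) <= (1 + a)^-1.
  rewrite expRN lef_pV2 ?posrE ?expR_gt0 ?ltr_pwDl //.
  exact: expR_ge1Dx.
apply: (@le_trans _ _ (1 + 2 * a ^+ 2)); last exact: expR_ge1Dx.
apply: (@le_trans _ _ (2^-1 * ((1 - a)^-1 + (1 + a)^-1))).
  by rewrite ler_wpM2l ?invr_ge0 // lerD.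
have -> : 2^-1 * ((1 - a)^-1 + (1 + a)^-1) = (1 - a ^+ 2)^-1.
  field; apply/and3P; split; nra.
rewrite -div1r ler_pdivrMr; nra.
Qed.

(** Independence: the average of a product over the signs is the product of the
    averages, each of which is a cosh. *)
Lemma rad_mgf (R : realType) m (a : 'I_m -> R) :
  sgn_avg (fun e => expR (rad a e)) <= expR (2 * \sum_i a i ^+ 2).
Proof.
rewrite /sgn_avg.
under eq_bigr do rewrite /rad expR_sum.
rewrite -(bigA_distr_bigA (fun i b => expR ((-1) ^+ nat_of_bool b * a i))) /=.
rewrite -[X in _ ^+ X]card_ord -prodr_const -big_split mulr_sumr expR_sum /=.
apply: ler_prod => i _; rewrite big_bool /= expr0 expr1 mul1r mulN1r.
by rewrite mulr_ge0 ?invr_ge0 ?addr_ge0 ?expR_ge0 //= addrC cosh_le.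
Qed.

Lemma radZ (R : realType) m (k : R) (a : 'I_m -> R) e :
  rad (fun i => k * a i) e = k * rad a e.
Proof. by rewrite /rad mulr_sumr; apply: eq_bigr => i _; rewrite mulrCA. Qed.

(** The maximum of N subgaussian sums is of order T = sqrt (log N), in the form
    of a random factor x with bounded second moment.  With
    x^2 = 1 + sum_j exp (l (Z_j - T)), a sum Z_j beyond T satisfies
    (Z_j / T)^2 <= exp (2 (Z_j / T - 1)) <= exp (l (Z_j - T)) as soon as
    l T >= 2, while l = T / 4 makes each term of mean at most
    exp (2 l^2 - l T) = exp (- T^2 / 8) <= 1 / N.  The factor 8 / ln 2 secures
    l T = T^2 / 4 >= 2 down to N = 2. *)
Lemma rad_max (R : realType) m (J : choiceType) (A : {fset J})
    (a : J -> 'I_m -> R) (T : R) :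
  (1 < #|` A|)%N -> (forall j, \sum_i a j i ^+ 2 <= 1) ->
  0 <= T -> T ^+ 2 = 8 / ln 2 * ln (#|` A|%:R) ->
  exists x : {ffun 'I_m -> bool} -> R,
    [/\ forall e, 0 < x e,
        forall e j, j \in A -> rad (a j) e <= T * x e
      & sgn_avg (fun e => x e ^+ 2) <= 2].
Proof.
move=> N2 a1 T0 T2.
set N : R := #|` A|%:R in T2 *.
have ln2_gt0 : 0 < ln 2 :> R by rewrite ln_gt0 // ltr1n.
have ln2_le1 : ln 2 <= 1 :> R.
  by rewrite -[2]/(1 + 1) le_ln1Dx // (lt_trans _ ltr01) // ltrN10.
have N2R : 2 <= N by rewrite ler_nat.
have lnN : ln 2 <= ln N by rewrite ler_ln ?posrE // (lt_le_trans _ N2R).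
have T8 : 8 <= T ^+ 2.
  by rewrite T2 mulrAC ler_pdivlMr // ler_pM2l.
have T28 : 8 * ln N <= T ^+ 2.
  rewrite T2 mulrAC ler_pdivlMr // -[leRHS]mulr1 ler_wpM2l //.
  lra.
have Tgt0 : 0 < T by rewrite lt_def T0 andbT; apply: contraTneq T8 => ->; lra.
pose l := T / 4.
pose y e := 1 + \sum_(j <- A) expR (l * (rad (a j) e - T)).
have y_ge1 e : 1 <= y e.
  by rewrite lerDl sumr_ge0 // => j _; exact: expR_ge0.
have yE e j : j \in A -> expR (l * (rad (a j) e - T)) <= y e.
  by move=> jA; rewrite /y (big_rem j) //= addrCA lerDl addr_ge0 // sumr_ge0.
exists (fun e => Num.sqrt (y e)); split.
- by move=> e; rewrite sqrtr_gt0 (lt_le_trans ltr01).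
- move=> e j jA; set z := rad (a j) e.
  have [zT|Tz] := leP z T.
    rewrite (le_trans zT) // ler_peMr // -(sqrtr1 R) ler_wsqrtr //.
  rewrite -ler_pdivrMl // mulrC -(ger0_norm (_ : 0 <= z / T)); last first.
    by rewrite divr_ge0 // (le_trans T0) // ltW.
  rewrite -sqrtr_sqr ler_wsqrtr // (le_trans _ (yE e j jA)) //.
  rewrite -/z.
  have h : z / T <= expR (z / T - 1).
    by have := expR_ge1Dx (z / T - 1); rewrite addrC subrK.
  apply: (@le_trans _ _ (expR (z / T - 1) ^+ 2)).
    by rewrite ler_sqr ?nnegrE ?expR_ge0 // divr_ge0 // (le_trans T0) // ltW.
  rewrite -expRM_natl ler_expR /l.
  have -> : T / 4 * (z - T) = (T ^+ 2 / 4) * (z / T - 1).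
    by field; rewrite gt_eqF.
  rewrite ler_wpM2r ?subr_ge0 ?ler_pdivlMr ?mul1r //; lra.
under [X in sgn_avg X]eq_fun do
  rewrite sqr_sqrtr ?(le_trans ler01) ?y_ge1 //.
rewrite sgn_avgD sgn_avg_cst sgn_avg_sum -[leRHS]/(1 + 1) lerD2l.
apply: (@le_trans _ _ (\sum_(j <- A) N^-1)); last first.
  rewrite big_const_seq count_predT iter_addr_0 -mulr_natr mulVf //.
  by rewrite gt_eqF // (lt_le_trans _ N2R).
apply: ler_sum => j _.
under [X in sgn_avg X]eq_fun do rewrite mulrBr expRD mulrC -radZ.
rewrite sgn_avgZ.
apply: (@le_trans _ _ (expR (- (l * T)) * expR (2 * l ^+ 2))).
  rewrite ler_wpM2l ?expR_ge0 // (le_trans (rad_mgf _)) // ler_expR.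
  rewrite ler_wpM2l //.
  under eq_bigr do rewrite exprMn.
  by rewrite -mulr_sumr ler_piMr ?sqr_ge0.
rewrite -expRD -[N in leRHS]lnK ?posrE ?(lt_le_trans _ N2R) // -expRN ler_expR.
rewrite /l; lra.
Qed.

(** * The D-optimal design *)

(** The matrix determinant lemma, from two block triangular factorizations of
    the bordered matrix with blocks A, -u, v, 1. *)
Lemma det_rank_one (F : fieldType) n (A : 'M[F]_n) (u : 'cV[F]_n)
    (v : 'rV[F]_n) :
  A \in unitmx ->
  \det (A + u *m v) = \det A * (1 + (v *m invmx A *m u) 0 0).
Proof.
move=> uA; pose B := block_mx A (- u) v (1%:M : 'M[F]_1).
have <- : \det B = \det (A + u *m v).
  have -> : \det B = \det (B *m block_mx 1%:M 0 (- v) 1%:M).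
    by rewrite det_mulmx det_lblock !det1 !mulr1.
  rewrite mulmx_block !mulmx1 !mulmx0 mulmxN mulNmx mul1mx opprK subrr !add0r.
  by rewrite det_ublock det1 mulr1.
have -> : B = block_mx 1%:M 0 (v *m invmx A) 1%:M
    *m block_mx A (- u) 0 (1%:M + v *m invmx A *m u).
  rewrite mulmx_block !mul1mx !mul0mx !addr0 mulmxKV // mulmxN.
  by rewrite (addrC (- _)) addrK.
by rewrite det_mulmx det_lblock det_ublock !det1 !mul1r det_mx11 !mxE.
Qed.

Lemma dotvE (R : realType) n (u x : 'rV[R]_n) : dotv u x = (u *m x^T) 0 0.
Proof. by rewrite mxE; apply: eq_bigr => i _; rewrite mxE. Qed.

Definition second_moment (R : realType) (m n : nat) (S : 'I_m -> 'rV[R]_n)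
    (c : 'I_m -> R) : 'M[R]_n :=
  \sum_(i < m) c i *: ((S i)^T *m S i).

Lemma second_moment_form (R : realType) m n (S : 'I_m -> 'rV[R]_n) c u v :
  (u *m second_moment S c *m v^T) 0 0
  = \sum_i c i * (dotv u (S i) * dotv (S i) v).
Proof.
rewrite /second_moment mulmx_sumr mulmx_suml summxE; apply: eq_bigr => i _.
rewrite -scalemxAr -scalemxAl mxE; congr (_ * _).
by rewrite !dotvE mulmxA -(mulmxA (u *m _)) [LHS]mxE big_ord1.
Qed.

Lemma dotvv_eq0 (R : realType) n (u : 'rV[R]_n) : dotv u u = 0 -> u = 0.
Proof.
move=> /eqP; rewrite psumr_eq0 => [/allP h|i _]; last by rewrite -expr2 sqr_ge0.
apply/rowP=> i; rewrite mxE; apply/eqP.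
by have := h i (mem_index_enum _); rewrite /= -expr2 sqrf_eq0.
Qed.

Lemma dotvC (R : realType) n (u x : 'rV[R]_n) : dotv u x = dotv x u.
Proof. by apply: eq_bigr => i _; rewrite mulrC. Qed.

Lemma second_moment_unit (R : realType) m n (S : 'I_m -> 'rV[R]_n) c :
  (forall i, 0 < c i) ->
  (forall w, (forall i, dotv w (S i) = 0) -> w = 0) ->
  second_moment S c \in unitmx.
Proof.
move=> c0 span; rewrite -row_free_unit; apply: inj_row_free => w wM.
apply: span => i.
have /eqP := second_moment_form S c w w; rewrite wM mul0mx mxE eq_sym.
rewrite psumr_eq0 => [/allP h|k _]; last first.
  by rewrite (dotvC (S k)) -expr2 mulr_ge0 ?sqr_ge0 // ltW.
have := h i (mem_index_enum _); rewrite /= (dotvC (S i)) -expr2.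
by rewrite mulf_eq0 gt_eqF //= sqrf_eq0 => /eqP.
Qed.

(** The absolute value spares a proof that determinants of positive matrices are
    positive: maximizing |det| serves equally well. *)
Lemma det_second_moment_continuous (R : realType) m n (S : 'I_m -> 'rV[R]_n) :
  continuous (fun c : 'rV[R]_m => `|\det (second_moment S (c 0))|).
Proof.
suff cdet : continuous (fun c : 'rV[R]_m => \det (second_moment S (c 0))).
  by move=> x; exact: (cvg_norm (cdet x)).
have ->: (fun c : 'rV[R]_m => \det (second_moment S (c 0)))
  = fun c => \sum_(s : {perm 'I_n}) (-1) ^+ s *
      \prod_i \sum_k c 0 k * ((S k)^T *m S k) i (s i).
  apply/funext => c; apply: eq_bigr => s _; congr (_ * _).
  apply: eq_bigr => i _; rewrite /second_moment summxE.
  by apply: eq_bigr => k _; rewrite [LHS]mxE.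
apply: continuous_big => [|s _]; first exact: add_continuous.
suff cprod : continuous (fun c : 'rV[R]_m =>
    \prod_i \sum_k c 0 k * ((S k)^T *m S k) i (s i)).
  by move=> x; exact: (cvgM (cvg_cst _) (cprod x)).
apply: continuous_big => [|i _]; first exact: mul_continuous.
apply: continuous_big => [|k _]; first exact: add_continuous.
by move=> x; exact: (cvgM (@coord_continuous _ _ _ 0 k x) (cvg_cst _)).
Qed.

Lemma simplex_compact (R : realType) m :
  compact [set c : 'rV[R]_m | (forall i, 0 <= c 0 i) /\ \sum_i c 0 i = 1].
Proof.
have cube : compact [set c : 'rV[R]_m | forall i, c ord0 i \in `[0, 1]].
  have := @rV_compact R m (fun=> `[0, 1]%classic).
  by move=> /(_ (fun=> @segment_compact R 0 1)).
have -> : [set c : 'rV[R]_m | (forall i, 0 <= c 0 i) /\ \sum_i c 0 i = 1]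
    = [set c : 'rV[R]_m | forall i, c ord0 i \in `[0, 1]]
      `&` (fun c : 'rV[R]_m => \sum_i c 0 i) @^-1` [set 1].
  apply/seteqP; split => c /=.
    move=> [c0 c1]; split => // i; rewrite in_itv /= c0 -c1 (bigD1 i) //= lerDl.
    by rewrite sumr_ge0.
  by move=> [c01 c1]; split => // i; have := c01 i; rewrite in_itv => /andP[].
apply: compact_closedI => //; apply: preimage_closed => [c _|];
  last exact: closed_eq.
move: c; apply: continuous_big => [|i _]; first exact: add_continuous.
exact: coord_continuous.
Qed.

Lemma bernoulli (R : realType) n (s : R) :
  0 <= s <= 1 -> 1 - n%:R * s <= (1 - s) ^+ n.
Proof.
move=> /andP[s0 s1]; elim: n => [|n IH]; first by rewrite mul0r subr0.
have n0 : 0 <= n%:R :> R by [].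
rewrite exprS; apply: (@le_trans _ _ ((1 - s) * (1 - n%:R * s))).
  by rewrite -natr1; nra.
by rewrite ler_wpM2l // subr_ge0.
Qed.

(** Kiefer-Wolfowitz: take c maximizing |det M| on the simplex.  Moving a mass s
    to the k-th point multiplies the determinant by
    (1 - s)^(n-1) (1 + s (q - 1)), where q = S_k M^-1 S_k^T.  This is
    1 + s (q - n) to first order, so maximality forces q <= n. *)
Lemma exists_optimal_design (R : realType) m n (S : 'I_m -> 'rV[R]_n) :
  (0 < n)%N ->
  (forall w, (forall i, dotv w (S i) = 0) -> w = 0) ->
  exists c : 'I_m -> R, 
    [/\ forall i, 0 <= c i, \sum_i c i = 1, second_moment S c \in unitmx
      & forall i, dotv (S i *m invmx (second_moment S c)) (S i) <= n%:R].
Proof.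
move=> n0 span.
have m0 : (0 < m)%N.
  rewrite lt0n; apply/eqP => m0.
  have := span (const_mx 1) => /(_ _)/rowP/(_ (Ordinal n0)).
  rewrite !mxE => h; suff : 1 = 0 :> R by move/eqP; rewrite oner_eq0.
  by apply: h => i; have := ltn_ord i; rewrite [X in (_ < X)%N]m0.
pose A := [set c : 'rV[R]_m | (forall i, 0 <= c 0 i) /\ \sum_i c 0 i = 1].
pose f (c : 'rV[R]_m) := `|\det (second_moment S (c 0))|.
pose c1 : 'rV[R]_m := const_mx m%:R^-1.
have Ac1 : A c1.
  split=> [i|]; first by rewrite mxE invr_ge0.
  under eq_bigr do rewrite mxE.
  by rewrite sumr_const card_ord -[LHS]mulr_natr mulVf // pnatr_eq0 -lt0n.
have [||c cA cmax] := @EVT_max_rV R m f A _ (@simplex_compact R m).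
- by exists c1.
- exact/continuous_subspaceT/det_second_moment_continuous.
have [c0 cs1] : A c by rewrite inE in cA.
have fc : 0 < f c.
  apply: lt_le_trans (cmax c1 _); last by rewrite inE.
  rewrite normr_gt0 -unitfE -unitmxE second_moment_unit // => i.
  by rewrite mxE invr_gt0 ltr0n.
set M := second_moment S (c 0) in fc *.
have uM : M \in unitmx by rewrite unitmxE unitfE -normr_gt0.
exists (c 0); split => // k; rewrite -/M leNgt; apply/negP => qn.
set q := dotv _ _ in qn.
have gain s : 0 < s < 1 -> (1 - s) ^+ n * (1 + s * (1 - s)^-1 * q) <= 1.
  move=> /andP[s0 s1].
  pose c' : 'rV[R]_m := (1 - s) *: c + s *: delta_mx 0 k.
  have c'E i : c' 0 i = (1 - s) * c 0 i + s * (i == k)%:R.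
    by rewrite !mxE eqxx.
  have : f c' <= f c.
    apply: cmax; rewrite inE; split=> [i|].
      by rewrite c'E addr_ge0 // mulr_ge0 // ?ltW // subr_gt0.
    under eq_bigr do rewrite c'E.
    rewrite big_split /= -!mulr_sumr cs1 (bigD1 k) //= eqxx big1.
      by rewrite addr0 !mulr1 subrK.
    by move=> i /negbTE ->.
  rewrite /f.
  have -> : second_moment S (c' 0) = (1 - s) *: M + (s *: (S k)^T) *m S k.
    rewrite /M /second_moment scaler_sumr -scalemxAl.
    under eq_bigr do rewrite c'E scalerDl -!scalerA.
    rewrite big_split /=; congr (_ + _).
    rewrite -scaler_sumr (bigD1 k) //= eqxx scale1r big1 ?addr0 //.
    by move=> i /negbTE ->; rewrite scale0r.
  have s1u : 1 - s \is a GRing.unit by rewrite unitfE subr_eq0 gt_eqF.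
  rewrite det_rank_one ?unitmxZ // detZ.
  have -> : (S k *m invmx ((1 - s) *: M) *m (s *: (S k)^T)) 0 0
      = s * (1 - s)^-1 * q.
    by rewrite invmxZ ?unitmxZ // -!scalemxAr -scalemxAl scalerA mxE -dotvE.
  rewrite mulrAC normrM -/M ger_pMl //; apply: le_trans.
  exact: ler_norm.
move: q qn gain; case: n n0 {S span A f c1 Ac1 c cA cmax c0 cs1 fc M uM k}.
  by [].
move=> n _ q qn gain.
have nn0 : 0 <= n%:R :> R by [].
pose d := q - n.+1%:R.
have d0 : 0 < d by rewrite subr_gt0.
have qE : q = n%:R + 1 + d by rewrite /d -natr1; ring.
(* s = d / D is below 1 and makes the second-order loss n (n + d) s^2 smaller
   than the first-order gain d s *)
pose D := n%:R * (n%:R + d) + d + 1.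
have nd : 0 <= n%:R * (n%:R + d) by rewrite mulr_ge0 // addr_ge0 // ltW.
have D0 : 0 < D by rewrite /D; lra.
have s01 : 0 < d / D < 1.
  by rewrite divr_gt0 //= ltr_pdivrMr // mul1r /D; lra.
have := gain _ s01; set s := d / D in s01 *.
have sD : s * D = d by rewrite divfK // gt_eqF.
apply/negP; rewrite -ltNge.
have -> : (1 - s) ^+ n.+1 * (1 + s * (1 - s)^-1 * q)
    = (1 - s) ^+ n * (1 + s * (n%:R + d)).
  by rewrite exprS qE; field; rewrite subr_eq0 gt_eqF; case/andP: s01.
have /andP[s0 s1] := s01.
have : 1 - n%:R * s <= (1 - s) ^+ n by apply: bernoulli; rewrite !ltW.
have pos : 0 < 1 + s * (n%:R + d).
  by rewrite ltr_pwDl // mulr_ge0 ?ltW // ltr_wpDl.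
rewrite -(ler_pM2r pos) => /(lt_le_trans _); apply.
have -> : (1 - n%:R * s) * (1 + s * (n%:R + d))
    = 1 + s * (d - s * (n%:R * (n%:R + d))) by ring.
rewrite ltrDl mulr_gt0 // -[X in X - _]sD -mulrBr mulr_gt0 // /D; lra.
Qed.

(** * Faces and vertices of a polytope *)

Lemma dotvDr (R : realType) n (u x y : 'rV[R]_n) :
  dotv u (x + y) = dotv u x + dotv u y.
Proof. by rewrite !dotvE linearD mulmxDr mxE. Qed.

Lemma dotvDl (R : realType) n (u x y : 'rV[R]_n) :
  dotv (x + y) u = dotv x u + dotv y u.
Proof. by rewrite !(dotvC _ u) dotvDr. Qed.

Lemma dotvZr (R : realType) n (u x : 'rV[R]_n) k :
  dotv u (k *: x) = k * dotv u x.
Proof. by rewrite !dotvE linearZ -scalemxAr mxE. Qed.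

Lemma dotvZl (R : realType) n (u x : 'rV[R]_n) k :
  dotv (k *: x) u = k * dotv x u.
Proof. by rewrite !(dotvC _ u) dotvZr. Qed.

Lemma dotvNr (R : realType) n (u x : 'rV[R]_n) : dotv u (- x) = - dotv u x.
Proof. by rewrite -scaleN1r dotvZr mulN1r. Qed.

Lemma dotvNl (R : realType) n (u x : 'rV[R]_n) : dotv (- x) u = - dotv x u.
Proof. by rewrite !(dotvC _ u) dotvNr. Qed.

Lemma dotv_sumr (R : realType) n m (u : 'rV[R]_n) (a : 'I_m -> R)
    (p : 'I_m -> 'rV[R]_n) :
  dotv u (\sum_i a i *: p i) = \sum_i a i * dotv u (p i).
Proof.
rewrite dotvE raddf_sum mulmx_sumr summxE; apply: eq_bigr => i _.
by rewrite -dotvE dotvZr.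
Qed.

Lemma polytope_range (R : realType) n (P : set 'rV[R]_n) :
  polytope P -> exists (m : nat) (S : 'I_m -> 'rV[R]_n),
    P = conv_hull (range S).
Proof.
move=> [[A /finite_seqP[s ->] ->] _].
exists (size s), (fun i => s`_i); congr conv_hull; apply/seteqP; split => x /=.
  by move=> /(nthP 0)[i si <-]; exists (Ordinal si).
by move=> [i _ <-]; rewrite mem_nth.
Qed.

Lemma conv_hull_sub (R : realType) n (A : set 'rV[R]_n) : A `<=` conv_hull A.
Proof.
move=> x Ax; exists 1%N, (fun=> x), (fun=> 1); split => //.
  by rewrite big_ord1.
by rewrite big_ord1 scale1r.
Qed.

Lemma conv_hull_dotv_le (R : realType) n (A : set 'rV[R]_n) u h :
  (forall x, A x -> dotv u x <= h) -> forall x, conv_hull A x -> dotv u x <= h.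
Proof.
move=> Ah x [m [p [a [pA a0 a1 ->]]]]; rewrite dotv_sumr.
rewrite -[leRHS]mul1r -a1 mulr_suml; apply: ler_sum => i _.
by rewrite ler_wpM2l // Ah.
Qed.

(** A linear form bounded by h on A reaches h at a convex combination only if
    all points of positive weight reach it. *)
Lemma conv_hull_face (R : realType) n (A : set 'rV[R]_n) u h x :
  (forall x, A x -> dotv u x <= h) -> conv_hull A x -> dotv u x = h ->
  exists (m : nat) (p : 'I_m -> 'rV[R]_n) (a : 'I_m -> R),
    [/\ forall i, A (p i), \sum_i a i = 1, x = \sum_i a i *: p i
      & forall i, a i = 0 \/ dotv u (p i) = h].
Proof.
move=> Ah [m [p [a [pA a0 a1 xE]]]] uxh; exists m, p, a; split => // i.
have sum0 : \sum_i a i * (h - dotv u (p i)) = 0.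
  under eq_bigr do rewrite mulrBr.
  by rewrite sumrB -mulr_suml a1 mul1r -dotv_sumr -xE uxh subrr.
move/eqP: sum0; rewrite psumr_eq0 => [/allP/(_ i (mem_index_enum _))/=|k _].
  rewrite mulf_eq0 subr_eq0 => /orP[/eqP|/eqP]; by [left|right].
by rewrite mulr_ge0 // subr_ge0 Ah.
Qed.

Lemma face_sub (R : realType) n (A F1 F2 : set 'rV[R]_n) :
  is_face (conv_hull A) F1 -> is_face (conv_hull A) F2 ->
  (forall x, A x -> F1 x -> F2 x) -> F1 `<=` F2.
Proof.
move=> [u1 [h1 [P1 ->]]] [u2 [h2 [P2 ->]]] sub x /= [Px ux].
split => //.
have Ah1 y : A y -> dotv u1 y <= h1 by move=> /(@conv_hull_sub _ _ A)/P1.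
have [m [p [a [pA a1 -> ah]]]] := conv_hull_face Ah1 Px ux.
rewrite dotv_sumr -[RHS]mul1r -a1 mulr_suml; apply: eq_bigr => i _.
have [->|pih] := ah i; first by rewrite !mul0r.
congr (_ * _).
by have [] := sub _ (pA i) (conj (conv_hull_sub (pA i)) pih).
Qed.

(** A face is determined by the generators that it contains ([face_sub]). *)
Lemma finite_faces (R : realType) n m (S : 'I_m -> 'rV[R]_n) :
  finite_set [set F | is_face (conv_hull (range S)) F].
Proof.
pose P := conv_hull (range S).
pose face_of (I : {set 'I_m}) :=
  xget set0 [set F | is_face P F /\ I = [set i | `[< F (S i) >]]%SET].
apply: (@sub_finite_set _ _ (range face_of)); last first.
  exact/finite_image/finite_finset.
move=> F /= PF; exists [set i | `[< F (S i) >]]%SET => //.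
rewrite /face_of; case: xgetP => [G _ [PG eqFG]|/(_ F)]; last by case.
have FG i : F (S i) <-> G (S i).
  move/setP/(_ i): eqFG; rewrite !inE => e.
  by split=> /asboolP; [rewrite e|rewrite -e] => /asboolP.
by apply/seteqP; split; apply: (@face_sub _ _ (range S)) => // _ [i _ <-] /FG.
Qed.

Lemma aff_dim0 (R : realType) n (p : 'rV[R]_n) : has_affdim [set p] 0.
Proof.
exists p, 0%VS; split; first exact: dimv0.
apply/seteqP; split => x /=.
  move=> [m [q [a [qp a1 ->]]]]; exists 0; first exact: mem0v.
  rewrite addr0 -[LHS]scale1r -a1 scaler_suml.
  by apply: eq_bigr => i _; rewrite (qp i).
move=> [w]; rewrite memv0 => /eqP -> <-; rewrite addr0.
by exists 1%N, (fun=> p), (fun=> 1); rewrite !big_ord1 scale1r.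
Qed.

(** Among the generators maximizing <y, .>, take one of largest norm, S_k.  By
    Cauchy-Schwarz it is the only maximizer of <S_k, .> among them, so
    t y + S_k, for t large, exposes it among all generators. *)
Lemma exists_max_vertex (R : realType) n m (S : 'I_m -> 'rV[R]_n)
    (y : 'rV[R]_n) :
  (0 < m)%N ->
  exists k, vertices (conv_hull (range S)) [set S k] /\
    forall i, dotv y (S i) <= dotv y (S k).
Proof.
move=> m0; pose i0 := Ordinal m0.
case: (@arg_maxP _ R 'I_m i0 xpredT (fun i => dotv y (S i))) => // j _ jmax0.
have jmax i : dotv y (S i) <= dotv y (S j) by exact: jmax0.
pose top i := dotv y (S i) == dotv y (S j).
case: (@arg_maxP _ R 'I_m j top (fun i => dotv (S i) (S i))).
  exact: eqxx.
move=> k /eqP yk kmax.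
exists k; split; last by move=> i; rewrite yk jmax.
pose gap i := dotv y (S j) - dotv y (S i).
(* large enough for t to exceed every quotient; where the gap is 0 the quotient
   is 0 by convention, and such i are treated apart *)
pose t := 1 + \sum_i `|dotv (S k) (S i - S k) / gap i|.
pose u := t *: y + S k.
have uS i : dotv u (S i - S k) = dotv (S k) (S i - S k) - t * gap i.
  rewrite /u dotvDl dotvZl addrC; congr (_ + _).
  by rewrite dotvDr dotvNr yk /gap -mulrN opprB.
have ult i : S i <> S k -> dotv u (S i) < dotv u (S k).
  move=> ik; rewrite -subr_lt0 -dotvNr -dotvDr uS.
  have [iT|iT] := boolP (top i).
    have -> : gap i = 0 by rewrite /gap (eqP iT) subrr.
    rewrite mulr0 subr0.
    have d0 : 0 < dotv (S i - S k) (S i - S k).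
      rewrite lt_def sumr_ge0 ?andbT; last first.
        by move=> l _; rewrite -expr2 sqr_ge0.
      by apply/eqP => /dotvv_eq0/eqP; rewrite subr_eq0 => /eqP.
    have : dotv (S i) (S i) <= dotv (S k) (S k) by exact: kmax.
    move: d0; rewrite !dotvDr !dotvNr !dotvDl !dotvNl (dotvC (S k) (S i)).
    lra.
  have gap0 : 0 < gap i.
    by rewrite subr_gt0 lt_def jmax // eq_sym iT.
  rewrite subr_lt0 -ltr_pdivrMr //.
  apply: (le_lt_trans (ler_norm _)).
  by rewrite /t (bigD1 i) //= addrCA ltrDl ltr_pwDl // sumr_ge0.
split; last exact: aff_dim0.
have ule x : range S x -> dotv u x <= dotv u (S k).
  move=> [i _ <-]; have [->//|/eqP ik] := eqVneq (S i) (S k).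
  exact/ltW/ult.
exists u, (dotv u (S k)); split; first exact: conv_hull_dotv_le.
apply/seteqP; split => [x /= ->|x /= [Px ux]].
  by split => //; apply: conv_hull_sub; exists k.
have [l [p [a [pA a1 -> ah]]]] := conv_hull_face ule Px ux.
rewrite -[RHS]scale1r -a1 scaler_suml; apply: eq_bigr => i _.
have [->|pk] := ah i; first by rewrite !scale0r.
congr (_ *: _); have [q _ qp] := pA i; rewrite -qp in pk *.
by have [//|/eqP/ult] := eqVneq (S q) (S k); rewrite pk ltxx.
Qed.

(** * The polar and the facets *)

(** Otherwise w would be nonpositive on P, hence zero on P = -P, which is
    impossible on a set with interior.  This is the only use of the interior:
    it says both that the generators span and that the polar is bounded. *)
Lemma sym_polytope_dotv_gt0 (R : realType) n m (S : 'I_m -> 'rV[R]_n) w :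
  interior (conv_hull (range S)) !=set0 ->
  centrally_symmetric (conv_hull (range S)) ->
  w != 0 -> exists i, 0 < dotv w (S i).
Proof.
move=> [x0 int_x0] sym w0; apply: contrapT => /forallNP wS.
set P := conv_hull (range S) in int_x0 sym.
have wP x : P x -> dotv w x <= 0.
  apply: conv_hull_dotv_le => _ [i _ <-].
  by rewrite leNgt; apply/negP/wS.
have wP0 x : P x -> dotv w x = 0.
  move=> Px; apply/eqP; rewrite eq_le wP // -oppr_le0 -dotvNr wP //.
  by rewrite sym; exists x.
have /nbhs_ballP[e /= e0 ballP] : nbhs x0 P by exact: int_x0.
have nw : 0 < `|w| by rewrite normr_gt0.
pose d := e / 2 / `|w|.
have d0 : 0 < d by rewrite !divr_gt0.
have Px1 : P (x0 + d *: w).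
  apply: ballP; rewrite -ball_normE /= opprD addrA subrr sub0r normrN.
  rewrite normrZ gtr0_norm // /d divfK ?gt_eqF // ltr_pdivrMr //; lra.
have := wP0 _ Px1; rewrite dotvDr wP0 ?add0r; last exact: nbhs_singleton.
rewrite dotvZr => /eqP; rewrite mulf_eq0 gt_eqF //= => /eqP/dotvv_eq0/eqP.
exact/negP.
Qed.

Definition polar (R : realType) m n (S : 'I_m -> 'rV[R]_n) (u : 'rV[R]_n) :=
  forall i, dotv u (S i) <= 1.

(** Rows of inactive constraints are set to 0 rather than dropped, so that the
    shape does not depend on u; the row space is the span of the active
    generators. *)
Definition active (R : realType) m n (S : 'I_m -> 'rV[R]_n) (u : 'rV[R]_n) :
    'M[R]_(m, n) :=
  \matrix_(i < m) (if dotv u (S i) == 1 then S i else 0).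

Lemma mulmx_active_eq0 (R : realType) m n (S : 'I_m -> 'rV[R]_n) u w :
  (w *m (active S u)^T == 0)
  = [forall i, (dotv u (S i) == 1) ==> (dotv w (S i) == 0)].
Proof.
have aE i : (w *m (active S u)^T) 0 i
    = if dotv u (S i) == 1 then dotv w (S i) else 0.
  rewrite mxE; under eq_bigr do rewrite !mxE.
  by case: ifP => // _; rewrite big1 // => j _; rewrite mxE mulr0.
apply/eqP/forallP => [w0 i|h].
  by have := aE i; rewrite w0 mxE; case: ifP => //= _ <-.
apply/rowP => i; rewrite aE mxE; case: ifP => // ui.
by have := h i; rewrite ui => /eqP.
Qed.

(** A linear form on the polar is maximal at an extreme point.  If the active
    generators at u do not span, move from u along some w orthogonal to them, in
    the direction that does not decrease <x, .>, until a new constraint becomes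
    active; this happens because some <w, S_i> is positive, and it increases the
    rank. *)
Lemma purify (R : realType) m n (S : 'I_m -> 'rV[R]_n) (x u : 'rV[R]_n) :
  (forall w, w != 0 -> exists i, 0 < dotv w (S i)) ->
  polar S u ->
  exists v, [/\ polar S v, row_full (active S v) & dotv x u <= dotv x v].
Proof.
move=> pos; have [k] := ubnP (n - \rank (active S u))%N.
elim: k u => // k IH u; rewrite ltnS => rk up.
have [full|notfull] := boolP (row_full (active S u)); first by exists u.
have [w [w0 wu xw]] : exists w,
    [/\ w != 0, w *m (active S u)^T == 0 & 0 <= dotv x w].
  have : kermx (active S u)^T != 0.
    by rewrite kermx_eq0 /row_free mxrank_tr.
  case/rowV0Pn => w /sub_kermxP/eqP wu w0.
  have [xw|/ltW xw] := leP 0 (dotv x w); first by exists w.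
  by exists (- w); rewrite mulNmx !oppr_eq0 dotvNr oppr_ge0.
have [i0 wi0] := pos w w0.
pose ratio i := (1 - dotv u (S i)) / dotv w (S i).
case: (@arg_minP _ R 'I_m i0 (fun i => 0 < dotv w (S i)) ratio)
  => // j /= wj jmin.
pose v := u + ratio j *: w.
have rj0 : 0 <= ratio j by rewrite divr_ge0 ?subr_ge0 ?up // ltW.
have vS i : dotv v (S i) = dotv u (S i) + ratio j * dotv w (S i).
  by rewrite dotvDl dotvZl.
have vp : polar S v.
  move=> i; rewrite vS; have [wi|wi] := leP (dotv w (S i)) 0.
    by rewrite (le_trans _ (up i)) // gerDl mulr_ge0_le0.
  have : ratio j <= ratio i by exact: jmin.
  by rewrite ler_pdivlMr // -lerBrDl.
have vj : dotv v (S j) == 1 by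
  rewrite vS /ratio divfK ?(gt_eqF wj) // addrC subrK.
have grow : (active S u < active S v)%MS.
  rewrite ltmxE; apply/andP; split.
    apply/row_subP => i; rewrite rowK; case: ifP => [ui|_]; last exact: sub0mx.
    have vi : dotv v (S i) == 1.
      move: wu; rewrite mulmx_active_eq0 => /forallP/(_ i).
      by rewrite ui /= => /eqP wi; rewrite vS wi mulr0 addr0.
    have -> : S i = row i (active S v) by rewrite rowK vi.
    exact: row_sub.
  apply/negP => /submxP[D vE].
  have : w *m (active S v)^T == 0.
    by rewrite vE trmx_mul mulmxA (eqP wu) mul0mx.
  rewrite mulmx_active_eq0 => /forallP/(_ j); rewrite vj /= => /eqP wj0.
  by rewrite wj0 ltxx in wj.
have rkn := rank_leq_col (active S v).
have rk2 := rank_ltmx grow.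
have [|v' [v'p v'f xv']] := IH v _ vp; first by lia.
exists v'; split => //; apply: le_trans xv'.
by rewrite dotvDr dotvZr lerDl mulr_ge0.
Qed.

Definition polar_face (R : realType) m n (S : 'I_m -> 'rV[R]_n)
    (u : 'rV[R]_n) : set 'rV[R]_n :=
  [set x | conv_hull (range S) x /\ dotv u x = 1].

(** When the active generators span, each y with <u, y> = 1 is a linear
    combination of them, and applying u shows that the coefficients sum to 1:
    the affine hull of the face is the whole hyperplane. *)
Lemma polar_face_facet (R : realType) m n (S : 'I_m -> 'rV[R]_n) u :
  (0 < n)%N -> polar S u -> row_full (active S u) ->
  facets (conv_hull (range S)) (polar_face S u).
Proof.
move=> n0 up full.
have act_pos : exists j, dotv u (S j) == 1.
  apply: contrapT => /forallNP h.
  have a0 : active S u = 0.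
    by apply/row_matrixP => i; rewrite rowK row0; case: ifP => // /h.
  by move: full n0; rewrite a0 /row_full mxrank0 => /eqP <-.
have [j /eqP uj] := act_pos.
have u0 : u != 0.
  apply: contra_eq_neq uj => ->; rewrite dotvE mul0mx mxE.
  by rewrite eq_sym oner_eq0.
split.
  exists u, 1; split => //; apply: conv_hull_dotv_le => _ [i _ <-]; exact: up.
exists n.-1; first by rewrite prednK.
pose f := linfun (mulmxr u^T : 'rV[R]_n -> 'M[R]_1).
have fE x : f x = (dotv u x)%:M.
  by rewrite lfunE /= [LHS]mx11_scalar dotvC dotvE.
have kerE x : (x \in lker f) = (dotv u x == 0).
  rewrite memv_ker fE; apply/eqP/eqP => [/matrixP/(_ 0 0)|->].
    by rewrite !mxE eqxx mulr1n.
  by rewrite raddf0.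
exists (S j), (lker f); split.
  have := limg_ker_dim f fullv; rewrite capfv dimvf /dim /=.
  suff -> : \dim (limg f) = 1%N by rewrite mul1n addn1 => e; rewrite -[in RHS]e.
  apply/eqP; rewrite eqn_leq; apply/andP; split.
    by have := dimvS (subvf (limg f)); rewrite dimvf /dim.
  rewrite lt0n dimv_eq0; apply/negP => /eqP f0.
  have := memv_img f (memvf (S j)); rewrite f0 memv0 fE uj => /eqP.
  by move/matrixP/(_ 0 0); rewrite !mxE /= mulr1n => /eqP; rewrite oner_eq0.
apply/seteqP; split => x /=.
  move=> [k [p [a [pF a1 ->]]]].
  exists (\sum_i a i *: p i - S j); last by rewrite addrC subrK.
  rewrite kerE dotvDr dotvNr dotv_sumr uj -a1 subr_eq0; apply/eqP.
  by apply: eq_bigr => i _; have [_ ->] := pF i; rewrite mulr1.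
move=> [w]; rewrite kerE => /eqP uw <-.
have /submxP[D wE] := submx_full (S j + w) full.
(* an inactive index keeps weight 0 at the dummy point S j of the face *)
pose p i := if dotv u (S i) == 1 then S i else S j.
pose a i := if dotv u (S i) == 1 then D 0 i else 0.
have pu i : dotv u (p i) = 1 by rewrite /p; case: ifP => // /eqP.
have xE : S j + w = \sum_i a i *: p i.
  rewrite wE mulmx_sum_row; apply: eq_bigr => i _.
  by rewrite rowK /a /p; case: ifP => // _; rewrite scaler0 scale0r.
exists m, p, a; split => //.
  move=> i; split => //; apply: conv_hull_sub; rewrite /p.
  by case: ifP => _; eexists.
have := congr1 (dotv u) xE; rewrite dotv_sumr dotvDr uj uw addr0 => ->.
by apply: eq_bigr => i _; rewrite pu mulr1.
Qed.

Lemma polar_face_inj (R : realType) m n (S : 'I_m -> 'rV[R]_n) u v :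
  row_full (active S u) -> polar_face S u = polar_face S v -> u = v.
Proof.
move=> full uv; apply/eqP; rewrite -subr_eq0.
have : (u - v) *m (active S u)^T == 0.
  rewrite mulmx_active_eq0; apply/forallP => i; apply/implyP => /eqP ui.
  have : polar_face S u (S i) by split => //; apply: conv_hull_sub; exists i.
  by rewrite uv => -[_ vi]; rewrite dotvDl dotvNl ui vi subrr.
move=> /eqP h.
have : row_free (active S u)^T by rewrite /row_free mxrank_tr.
by move/row_free_inj => inj; apply/eqP/inj; rewrite h mul0mx.
Qed.

(** * The random point and its dual *)

Definition random_point (R : realType) m n (S : 'I_m -> 'rV[R]_n)
    (c : 'I_m -> R) (e : {ffun 'I_m -> bool}) : 'rV[R]_n :=
  \sum_i ((-1) ^+ e i * Num.sqrt (c i)) *: S i.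

Lemma dotv_random_point (R : realType) m n (S : 'I_m -> 'rV[R]_n) c u e :
  dotv u (random_point S c e) = rad (fun i => Num.sqrt (c i) * dotv u (S i)) e.
Proof. by rewrite dotv_sumr; apply: eq_bigr => i _; rewrite mulrA. Qed.

(** The random point has covariance matrix M. *)
Lemma avg_random_point_form (R : realType) m n (S : 'I_m -> 'rV[R]_n) c A :
  (forall i, 0 <= c i) ->
  sgn_avg (fun e => dotv (random_point S c e *m A) (random_point S c e))
  = \tr (second_moment S c *m A).
Proof.
move=> c0.
pose q i j := Num.sqrt (c i) * Num.sqrt (c j) * dotv (S i *m A) (S j).
have formE e : dotv (random_point S c e *m A) (random_point S c e)
    = \sum_i \sum_j q i j * ((-1) ^+ e i * (-1) ^+ e j).
  rewrite dotvC {2}/random_point mulmx_suml.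
  under eq_bigr do rewrite -scalemxAl.
  rewrite dotv_sumr; apply: eq_bigr => i _.
  rewrite dotvC {1}/random_point dotv_sumr mulr_sumr; apply: eq_bigr => j _.
  by rewrite /q; ring.
under [in LHS]eq_fun do rewrite formE.
rewrite sgn_avg_sum /second_moment mulmx_suml raddf_sum /=.
apply: eq_bigr => i _; rewrite sgn_avg_sum.
under eq_bigr do rewrite sgn_avgZ sgn_avg_mul.
rewrite (bigD1 i) //= eqxx mulr1 big1 ?addr0; last first.
  by move=> j ji; rewrite eq_sym (negbTE ji) mulr0.
rewrite /q -expr2 sqr_sqrtr // -scalemxAl linearZ /=; congr (_ * _).
by rewrite -mulmxA mxtrace_mulC dotvE [RHS]/mxtrace big_ord1.
Qed.

(** Names the supporting functionals by the facets themselves, so that a union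
    bound over them costs the number of facets.  The default 0 lies in the
    polar, so that all values of g do. *)
Lemma facet_functionals (R : realType) m n (S : 'I_m -> 'rV[R]_n) :
  (0 < n)%N -> (forall w, w != 0 -> exists i, 0 < dotv w (S i)) ->
  exists g : set 'rV[R]_n -> 'rV[R]_n, (forall F, polar S (g F)) /\
    forall x u, polar S u ->
      exists2 F, F \in fset_set (facets (conv_hull (range S)))
               & dotv x u <= dotv x (g F).
Proof.
move=> n0 pos.
pose supp F := [set u | [/\ polar S u, row_full (active S u)
                          & polar_face S u = F]].
exists (fun F => xget 0 (supp F)); split.
  move=> F; case: xgetP => [u _ []//|_] i.
  by rewrite dotvE mul0mx mxE.
move=> x u up; have [v [vp vfull xuv]] := purify x pos up.
exists (polar_face S v).
  rewrite in_fset_set.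
    by rewrite inE; exact: polar_face_facet.
  by apply: sub_finite_set (finite_faces S) => F [].
case: xgetP => [w _ [_ _ wv]|/(_ v)]; last by case.
by rewrite -(polar_face_inj vfull (esym wv)).
Qed.

Lemma vertex_points (R : realType) m n (S : 'I_m -> 'rV[R]_n) :
  (0 < m)%N ->
  exists h : set 'rV[R]_n -> 'rV[R]_n,
    (forall F, h F = 0 \/ exists i, h F = S i) /\
    forall y, exists2 F, F \in fset_set (vertices (conv_hull (range S)))
               & forall i, dotv y (S i) <= dotv y (h F).
Proof.
move=> m0.
pose pt (F : set 'rV[R]_n) := [set p | range S p /\ F = [set p]].
exists (fun F => xget 0 (pt F)); split.
  move=> F; case: xgetP => [p _ [[i _ <-] _]|_]; last by left.
  by right; exists i.
move=> y; have [k [kv kmax]] := exists_max_vertex S y m0.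
exists [set S k].
  rewrite in_fset_set ?inE //.
  by apply: sub_finite_set (finite_faces S) => F [].
case: xgetP => [p _ [_ kp]|/(_ (S k))]; last by case; split => //; exists k.
by have -> : p = S k by have : [set p] p by []; rewrite -kp.
Qed.

(** One index serves a direction y, another one -y.  Two is needed for the
    logarithms to be positive. *)
Lemma card_gt1_of_pos (R : realType) n (J : choiceType) (A : {fset J})
    (g : J -> 'rV[R]_n) :
  (0 < n)%N ->
  (forall y, y != 0 -> exists2 j, j \in A & 0 < dotv y (g j)) ->
  (1 < #|` A|)%N.
Proof.
move=> n0 pos; pose y : 'rV[R]_n := const_mx 1.
have y0 : y != 0.
  apply/eqP => /rowP/(_ (Ordinal n0)); rewrite !mxE => /eqP.
  by rewrite oner_eq0.
have [j jA yj] := pos _ y0.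
have [k kA yk] : exists2 k, k \in A & 0 < dotv (- y) (g k).
  by apply: pos; rewrite oppr_eq0.
have jk : j != k.
  apply/eqP => jk; move: yk; rewrite -jk dotvNl oppr_gt0 => /lt_trans/(_ yj).
  by rewrite ltxx.
have <- : #|` [fset j; k]%fset| = 2%N by rewrite cardfs2 jk.
by apply: fsubset_leq_card; apply/fsubsetP => i; rewrite !inE => /orP[]/eqP->.
Qed.

Lemma polar_scaled (R : realType) m n (S : 'I_m -> 'rV[R]_n) x :
  exists2 b, 0 < b & polar S (b^-1 *: x).
Proof.
have b0 : 0 < 1 + \sum_i `|dotv x (S i)| by rewrite ltr_pwDl // sumr_ge0.
exists (1 + \sum_i `|dotv x (S i)|) => // i.
rewrite dotvZl ler_pdivrMl // mulr1 (le_trans (ler_norm _)) //.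
by rewrite (bigD1 i) //= addrCA lerDl addr_ge0 // sumr_ge0.
Qed.

(** The averaging argument, with 8 / ln 2 * log the square of the scale T of
    [rad_max]. *)
Lemma dim_le_log_log (R : realType) m n (S : 'I_m -> 'rV[R]_n) :
  (0 < n)%N -> (forall w, w != 0 -> exists i, 0 < dotv w (S i)) ->
  centrally_symmetric (conv_hull (range S)) ->
  n%:R <= 4 * (8 / ln 2 * ln (card_set (vertices (conv_hull (range S))))%:R)
            * (8 / ln 2 * ln (card_set (facets (conv_hull (range S))))%:R) :> R.
Proof.
move=> n0 pos sym; rewrite /card_set.
set P := conv_hull (range S) in sym *.
set V := fset_set (vertices P); set F := fset_set (facets P).
have m0 : (0 < m)%N.
  have [|i _] := pos (const_mx 1); last exact: leq_ltn_trans (ltn_ord i).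
  apply/eqP => /rowP/(_ (Ordinal n0)); rewrite !mxE => /eqP.
  by rewrite oner_eq0.
have [g [gpol gmax]] := facet_functionals n0 pos.
have [h [hS hmax]] := vertex_points S m0.
rewrite -/P -/F in gmax; rewrite -/P -/V in hmax.
have V2 : (1 < #|` V|)%N.
  apply: (card_gt1_of_pos (g := h) n0) => y /pos[i yi].
  by have [j jV yj] := hmax y; exists j => //; apply: lt_le_trans (yj i).
have F2 : (1 < #|` F|)%N.
  apply: (card_gt1_of_pos (g := g) n0) => y y0.
  have [b b0 /(gmax y)[j jF yj]] := polar_scaled S y.
  exists j => //; apply: lt_le_trans yj; rewrite dotvZr mulr_gt0 ?invr_gt0 //.
  rewrite lt_def sumr_ge0 ?andbT => [|i _]; last by rewrite -expr2 sqr_ge0.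
  by apply: contra_neq y0 => /dotvv_eq0.
have ln2_gt0 : 0 < ln 2 :> R by rewrite ln_gt0 // ltr1n.
have log_gt0 k : (1 < k)%N -> 0 < 8 / ln 2 * ln k%:R :> R.
  by move=> k1; rewrite mulr_gt0 ?divr_gt0 // ln_gt0 // ltr1n.
set lV := 8 / ln 2 * ln #|` V|%:R; set lF := 8 / ln 2 * ln #|` F|%:R.
have lV0 : 0 < lV := log_gt0 _ V2.
have lF0 : 0 < lF := log_gt0 _ F2.
have span w : (forall i, dotv w (S i) = 0) -> w = 0.
  move=> w0; apply/eqP; apply: contraT => /pos[i].
  by rewrite w0 ltxx.
have [c [c0 c1 uM lev]] := exists_optimal_design n0 span.
set M := second_moment S c in uM lev.
have symM : M^T = M.
  rewrite /M /second_moment linear_sum /=; apply: eq_bigr => i _.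
  by rewrite linearZ /= trmx_mul trmxK.
have symMV : (invmx M)^T = invmx M by rewrite trmx_inv symM.
have nR0 : 0 < n%:R :> R by rewrite ltr0n.
pose rn : R := Num.sqrt n%:R.
have rn0 : 0 < rn by rewrite sqrtr_gt0.
have rn2 : rn ^+ 2 = n%:R by rewrite sqr_sqrtr // ltW.
(* central symmetry enters here: it bounds <g f, S_i> from below *)
have gS f i : dotv (g f) (S i) ^+ 2 <= 1.
  have gP x : P x -> dotv (g f) x <= 1.
    by apply: conv_hull_dotv_le => _ [j _ <-]; exact: gpol.
  have PS : P (S i) by apply: conv_hull_sub; exists i.
  have := gP _ PS; have : dotv (g f) (- S i) <= 1.
    by apply: gP; rewrite sym; exists (S i).
  rewrite dotvNr; nra.
have coefF f : \sum_i (Num.sqrt (c i) * dotv (g f) (S i)) ^+ 2 <= 1.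
  rewrite -c1; apply: ler_sum => i _.
  by rewrite exprMn sqr_sqrtr // ler_piMr.
have coefV f :
    \sum_i (rn^-1 * (Num.sqrt (c i) * dotv (h f *m invmx M) (S i))) ^+ 2 <= 1.
  have -> : \sum_i (rn^-1 * (Num.sqrt (c i) * dotv (h f *m invmx M) (S i))) ^+ 2
      = n%:R^-1 * dotv (h f *m invmx M) (h f).
    transitivity (n%:R^-1 *
        ((h f *m invmx M) *m M *m (h f *m invmx M)^T) 0 0).
      rewrite second_moment_form mulr_sumr; apply: eq_bigr => i _.
      by rewrite !exprMn sqr_sqrtr // exprVn rn2 (dotvC (S i)) -expr2.
    by rewrite mulmxKV // -dotvE dotvC.
  rewrite ler_pdivrMl // mulr1; case: (hS f) => [->|[i ->]]; last exact: lev.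
  by rewrite mul0mx dotvE mul0mx mxE ltW.
have [xF [xF0 xFmax xF2]] := rad_max F2 coefF (sqrtr_ge0 _)
  (sqr_sqrtr (ltW lF0)).
have [xV [xV0 xVmax xV2]] := rad_max V2 coefV (sqrtr_ge0 _)
  (sqr_sqrtr (ltW lV0)).
set TF := Num.sqrt _ in xFmax; set TV := Num.sqrt _ in xVmax.
have TF0 : 0 < TF by rewrite sqrtr_gt0.
have TV0 : 0 < TV by rewrite sqrtr_gt0.
pose X := random_point S c.
(* <X, Y> <= gauge(X) * support(Y), the support function of P at Y being at most
   b; the product of the random factors is split by the arithmetic-geometric
   mean inequality *)
have dual e : dotv (X e *m invmx M) (X e)
    <= rn * TV * TF / 2 * (xF e ^+ 2 + xV e ^+ 2).
  pose y := X e *m invmx M.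
  pose b := rn * TV * xV e.
  have b0 : 0 < b by rewrite !mulr_gt0.
  have polb : polar S (b^-1 *: y).
    move=> i; rewrite dotvZl ler_pdivrMl // mulr1.
    have [f fV yf] := hmax y; rewrite (le_trans (yf i)) //.
    have -> : dotv y (h f) = dotv (h f *m invmx M) (X e).
      by rewrite dotvC !dotvE /y trmx_mul symMV mulmxA.
    rewrite dotv_random_point /b -mulrA -ler_pdivrMl // -radZ.
    exact: xVmax.
  have [f fF] := gmax (X e) _ polb.
  rewrite dotvZr ler_pdivrMl // (dotvC _ y) => /le_trans; apply.
  rewrite (dotvC _ (g f)) dotv_random_point.
  apply: (@le_trans _ _ (b * (TF * xF e))).
    by rewrite ler_pM2l //; exact: xFmax.
  have -> : b * (TF * xF e) = (rn * TV * TF / 2) * (2 * (xF e * xV e)).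
    by rewrite /b; field.
  rewrite ler_wpM2l //; last by have := sqr_ge0 (xF e - xV e); nra.
  by rewrite ltW // divr_gt0 // !mulr_gt0.
have := ler_sgn_avg dual.
rewrite avg_random_point_form // mulmxV // mxtrace1 sgn_avgZ sgn_avgD => hn.
have {}hn : n%:R <= 2 * (rn * TV * TF).
  apply: (le_trans hn).
  apply: (@le_trans _ _ (rn * TV * TF / 2 * (2 + 2))); last by lra.
  by rewrite ler_wpM2l ?lerD // ltW // divr_gt0 // !mulr_gt0.
have {}hn : rn <= 2 * (TV * TF).
  by rewrite -(ler_pM2l rn0) -expr2 rn2; lra.
rewrite -rn2; apply: (@le_trans _ _ ((2 * (TV * TF)) ^+ 2)).
  by apply: lerXn2r => //; rewrite nnegrE ltW // !mulr_gt0.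
have TF2 : TF ^+ 2 = lF by exact/sqr_sqrtr/ltW.
have TV2 : TV ^+ 2 = lV by exact/sqr_sqrtr/ltW.
rewrite !exprMn TF2 TV2; lra.
Qed.

Theorem corollary1p2 (R : realType) :
  exists c : R, 0 < c /\
    forall (n : nat) (P : set 'rV[R]_n),
      polytope P -> centrally_symmetric P ->
      c * n%:R <= ln ((card_set (vertices P))%:R : R)
                  * ln ((card_set (facets P))%:R : R).
Proof.
have ln2_gt0 : 0 < ln 2 :> R by rewrite ln_gt0 // ltr1n.
exists ((ln 2) ^+ 2 / 256); split; first by rewrite divr_gt0 ?exprn_gt0.
move=> [|n] P polyP symP.
  have -> : facets P = set0 by rewrite -subset0 => F [_ [d]].
  rewrite [X in _ * ln X%:R]/card_set fset_set0 cardfs0.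
  by rewrite (ln0 (lexx 0)) !mulr0.
have [m [S PE]] := polytope_range polyP.
have [_ intP] := polyP; rewrite PE in intP symP *.
have := dim_le_log_log (ltn0Sn n)
  (fun w => @sym_polytope_dotv_gt0 _ _ _ S w intP symP) symP.
set lV := ln _; set lF := ln _ => h.
rewrite mulrAC ler_pdivrMr // mulrC -ler_pdivlMr ?exprn_gt0 //.
apply: (le_trans h); rewrite le_eqVlt; apply/orP; left; apply/eqP.
by field; rewrite gt_eqF.
Qed.
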